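(* Let $\mu\in\mathbb R$ and let $q(j)=\delta j^2+\beta j+\gamma$ be a real polynomial of degree at most two. Put $\underline q(j)=q(j)+j-\mu$, $$\alpha=\sup\{j\in(-\infty,\mu]\cap\mathbb Z:\underline q(j)=0\},\qquad \omega=\inf\{j\in[\mu,\infty)\cap\mathbb Z: q(j)=0\}$$ (with $\sup\varnothing=-\infty$, $\inf\varnothing=\infty$), $S=[\alpha,\omega]\cap\mathbb Z$, $S^\circ=S\setminus\{\omega\}$ and $S_\circ=S\setminus\{\alpha\}$. Then the pair $(\mu;q)$ is admissible if and only if $q(j)>0$ for all $j\in S^\circ$ and $\underline q(j)>0$ for all $j\in S_\circ$. Moreover, if $(\mu;q)$ is admissible, then, with $r(j)=q(j)/\underline q(j+1)$ for $j\in S^\circ$, the pmf $p\sim\mathrm{CO}(\mu;q)$ is supported on $S$ and is given there, up to the normalizing constant, by: if $\alpha>-\infty$, $p(\alpha+i)\propto r^{[i]}(\alpha)$, $i=0,1,\ldots,\omega-\alpha$; if $\alpha=-\infty$ and $\omega<\infty$, $p(\omega-i)\propto r^{[-i]}(\omega)$, $i=0,1,\ldots$; if $\alpha=-\infty$ and $\omega=\infty$, $p(j)\propto r^{[j]}(0)$, $j\in\mathbb Z$.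
   Context: A pmf $p$ on $\mathbb Z$ with finite mean $\mu$ belongs to the Cumulative Ord system, written $p\sim\mathrm{CO}(\mu;q)$, where $q$ is a real polynomial of degree at most two, if $\sum_{k\le j}(\mu-k)p(k)=q(j)p(j)$ for all $j\in\mathbb Z$. A pair $(\mu;q)$ is called admissible if there exists a pmf $p$ on $\mathbb Z$ with mean $\mu$ such that $p\sim\mathrm{CO}(\mu;q)$. Notation: for $k=0,1,\ldots$, $f^{[k]}(x)=f(x)f(x+1)\cdots f(x+k-1)$, $f^{[-k]}(x)=1/[f(x-1)f(x-2)\cdots f(x-k)]$, $f^{[0]}=1$. *)

(* Defs.v *)
From mathcomp Require Import all_boot all_order all_algebra.
From mathcomp Require Import boolp classical_sets reals constructive_ereal ereal.
From mathcomp Require Import numfun esum.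

Set Implicit Arguments.
Unset Strict Implicit.
Unset Printing Implicit Defensive.

Import Order.TTheory GRing.Theory Num.Theory.

Local Open Scope classical_set_scope.
Local Open Scope ring_scope.

(* [esum] is only meant for nonnegative families; a signed family is summed as
   the difference of the sums of its positive and negative parts. Since
   +oo - +oo = -oo in \bar R, an equation zsum D f = x%:E forces f to be
   absolutely summable on D. *)
Definition zsum (R : realType) (D : set int) (f : int -> R) : \bar R :=
  ((\esum_(k in D) (EFin \o f)^\+ k) - (\esum_(k in D) (EFin \o f)^\- k))%E.

Definition is_pmf (R : realType) (p : int -> R) : Prop :=
  (forall j, 0 <= p j) /\ (\esum_(j in [set: int]) (p j)%:E = 1)%E.

Definition has_mean (R : realType) (p : int -> R) (mu : R) : Prop :=
  summable [set: int] (fun k => (k%:~R * p k)%:E) /\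
  zsum [set: int] (fun k => k%:~R * p k) = mu%:E.

(* p ~ CO(mu; q); [size q <= 3] means degree at most two. *)
Definition CO (R : realType) (mu : R) (q : {poly R}) (p : int -> R) : Prop :=
  [/\ (size q <= 3)%N, is_pmf p, has_mean p mu &
      forall j : int, zsum [set k | (k <= j)%R] (fun k => (mu - k%:~R) * p k)
                      = (q.[j%:~R] * p j)%:E].

Definition admissible (R : realType) (mu : R) (q : {poly R}) : Prop :=
  exists p : int -> R, CO mu q p.

Definition qlow (R : realType) (mu : R) (q : {poly R}) : {poly R} :=
  q + 'X - mu%:P.

(* Endpoints are extended reals: ereal_sup set0 = -oo, ereal_inf set0 = +oo. *)
Definition CO_alpha (R : realType) (mu : R) (q : {poly R}) : \bar R :=
  ereal_sup [set (j%:~R : R)%:E |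
    j in [set j : int | j%:~R <= mu /\ (qlow mu q).[j%:~R] = 0]].

Definition CO_omega (R : realType) (mu : R) (q : {poly R}) : \bar R :=
  ereal_inf [set (j%:~R : R)%:E |
    j in [set j : int | mu <= j%:~R /\ q.[j%:~R] = 0]].

Definition CO_set (R : realType) (mu : R) (q : {poly R}) : set int :=
  [set j | (CO_alpha mu q <= (j%:~R : R)%:E <= CO_omega mu q)%E].

Definition CO_setDomega (R : realType) (mu : R) (q : {poly R}) : set int :=
  CO_set mu q `\` [set j | (j%:~R : R)%:E = CO_omega mu q].

Definition CO_setDalpha (R : realType) (mu : R) (q : {poly R}) : set int :=
  CO_set mu q `\` [set j | (j%:~R : R)%:E = CO_alpha mu q].

(* Only meaningful for j in CO_setDomega mu q; division is total elsewhere. *)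
Definition CO_ratio (R : realType) (mu : R) (q : {poly R}) (j : int) : R :=
  q.[j%:~R] / (qlow mu q).[(j + 1)%:~R].

(* [asc f k x] is f^[k](x): f(x) f(x+1) ... f(x+k-1) for k >= 0, and
   1 / (f(x-1) f(x-2) ... f(x-n)) for k = -n < 0 (Negz n is -(n+1)). *)
Definition asc (R : realType) (f : int -> R) (k : int) (x : int) : R :=
  match k with
  | Posz n => \prod_(i < n) f (x + i%:Z)
  | Negz n => (\prod_(i < n.+1) f (x - i.+1%:Z))^-1
  end.

(* f = C g on D for a positive constant C. *)
Definition propto (R : realType) (T : Type) (D : set T) (f g : T -> R) : Prop :=
  exists2 C : R, 0 < C & forall t, D t -> f t = C * g t.

(* Main.v *)
(* Put F(j) = q(j) p(j), so that F(j) - F(j-1) = (mu - j) p(j), equivalently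
   qlow(j) p(j) = q(j-1) p(j-1). If p ~ CO(mu; q) then F(j) is a sum of
   nonnegative terms for j < mu, and, the mean being mu, minus a sum of
   nonpositive terms over k > j for j + 1 > mu; hence F >= 0, and F(j) vanishes
   only when p carries no mass on the corresponding side. This makes the support
   an interval which ends exactly at the zeros alpha and omega, and on it the
   recurrence determines p up to a constant.
   Conversely, a nonnegative solution p of the recurrence with F >= 0 is
   automatically summable with first moment: F is monotone on each side of mu,
   so the sum of |k - mu| p(k) telescopes to at most 2 F(floor mu). Moreover F
   tends to 0 at both ends: if F >= L > 0 then p(k) >= L / q(k) >= c / k^2, as
   deg q <= 2, and the sum of |k| p(k) would diverge. *)

Require Import Defs.
From mathcomp Require Import all_boot all_order all_algebra.
From mathcomp Require Import boolp classical_sets functions cardinality fsbigop.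
From mathcomp Require Import reals constructive_ereal ereal.
From mathcomp Require Import topology normedtype sequences numfun esum.
From mathcomp Require Import zify ring lra.

Set Implicit Arguments.
Unset Strict Implicit.
Unset Printing Implicit Defensive.

Import Order.TTheory GRing.Theory Num.Theory. Import numFieldNormedType.Exports.

Local Open Scope classical_set_scope.
Local Open Scope ring_scope.

(** * Signed sums over the integers *)

Lemma summable_ge0 (R : realType) (T : choiceType) (D : set T) (f : T -> R) :
  (forall t, D t -> 0 <= f t) -> (\esum_(t in D) (f t)%:E < +oo)%E ->
  summable D (EFin \o f).
Proof.
move=> f0; apply: le_lt_trans; apply: le_esum => t Dt /=.
by rewrite ger0_norm ?f0.
Qed.

Lemma summable_sub (R : realType) (T : choiceType) (D E : set T)
    (f : T -> \bar R) : D `<=` E -> summable E f -> summable D f.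
Proof.
move=> DE; apply: le_lt_trans.
have ED : E `&` D = D by apply/setIidPr.
by rewrite [leRHS](esumID D) //= ED leeDl //; exact: esum_ge0.
Qed.

(** One inequality for positive constants suffices: applied to [c^-1] and the family [c * f], it
    gives the reverse one. *)
Lemma esumZ (R : realType) (T : choiceType) (D : set T) (c : R) (f : T -> R) :
  0 <= c -> (forall t, 0 <= f t) ->
  \esum_(t in D) (c * f t)%:E = (c%:E * \esum_(t in D) (f t)%:E)%E.
Proof.
have le (a : R) (g : T -> R) : 0 < a -> (forall t, 0 <= g t) ->
    (\esum_(t in D) (a * g t)%:E <= a%:E * \esum_(t in D) (g t)%:E)%E.
  move=> a0 g0; rewrite ge_ereal_sup => //= _ [X [finX XD]] <-.
  under eq_fsbigr => i _ do rewrite EFinM.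
  rewrite -ge0_mule_fsumr //.
  rewrite lee_pmul2l ?fin_numE ?lte_fin //; apply: esum_ge.
  by exists X.
rewrite le_eqVlt => /predU1P[<- _|c0 f0].
  by rewrite mul0e esum1 // => t _; rewrite mul0r.
apply/eqP; rewrite eq_le le //=.
rewrite -lee_pdivlMl // (_ : (\esum_(t in D) (f t)%:E)%E =
  (\esum_(t in D) (c^-1 * (c * f t))%:E)%E).
  by apply: le; rewrite ?invr_gt0 // => t; rewrite mulr_ge0 ?f0 // ltW.
by apply: eq_esum => t Dt; rewrite mulKf ?gt_eqF.
Qed.

(** Frees [zsum] from the canonical positive and negative parts: any splitting into nonnegative
    families with finite sums gives the same value. *)
Lemma zsumB (R : realType) (D : set int) (f u v : int -> R) :
  (forall k, D k -> 0 <= u k) -> (forall k, D k -> 0 <= v k) ->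
  (\esum_(k in D) (u k)%:E < +oo)%E -> (\esum_(k in D) (v k)%:E < +oo)%E ->
  (forall k, f k = u k - v k) ->
  zsum D f = (\esum_(k in D) (u k)%:E - \esum_(k in D) (v k)%:E)%E.
Proof.
move=> u0 v0 us vs fE; rewrite /zsum.
rewrite (_ : EFin \o f = (EFin \o u) \- (EFin \o v))%E; last first.
  by apply/funext => k /=; rewrite fE EFinB.
by rewrite esumB //; exact: summable_ge0.
Qed.

Lemma zsum_ge0 (R : realType) (D : set int) (f : int -> R) :
  (forall k, D k -> 0 <= f k) -> zsum D f = \esum_(k in D) (f k)%:E.
Proof.
move=> f0; rewrite /zsum [X in (_ - X)%E]esum1 ?sube0.
  by apply: eq_esum => k Dk; rewrite funeposE /= max_l // lee_fin f0.
by move=> k Dk; rewrite funenegE /= max_r // lee_fin oppr_le0 f0.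
Qed.

Lemma zsum_le0 (R : realType) (D : set int) (f : int -> R) :
  (forall k, D k -> f k <= 0) -> zsum D f = (- \esum_(k in D) (- f k)%:E)%E.
Proof.
move=> f0; rewrite /zsum esum1 ?sub0e.
  congr (- _)%E; apply: eq_esum => k Dk.
  by rewrite funenegE /= max_l // lee_fin oppr_ge0 f0.
by move=> k Dk; rewrite funeposE /= max_r // lee_fin f0.
Qed.

Lemma zsum_fin_num (R : realType) (D : set int) (f : int -> R) :
  summable D (EFin \o f) -> zsum D f \is a fin_num.
Proof.
move=> sf; rewrite /zsum fin_numB.
have /summable_funepos := sf; have /summable_funeneg := sf.
rewrite !summableE => h1 h2; apply/andP; split.
  by move: h2; congr (_ \is a _); apply: eq_esum => k _; rewrite gee0_abs.
by move: h1; congr (_ \is a _); apply: eq_esum => k _; rewrite gee0_abs.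
Qed.

Lemma zsumID (R : realType) (B D : set int) (f : int -> R) :
  summable D (EFin \o f) ->
  zsum D f = (zsum (D `&` B) f + zsum (D `&` ~` B) f)%E.
Proof.
move=> sf.
have sn E : E `<=` D -> \esum_(k in E) (EFin \o f)^\-%E k \is a fin_num.
  move=> /summable_sub /(_ sf) /summable_funeneg.
  rewrite summableE; congr (_ \is a _); apply: eq_esum => k _.
  by rewrite gee0_abs.
rewrite /zsum (esumID B D) // [X in (_ - X)%E](esumID B D) //.
rewrite fin_num_oppeD; last by apply: sn => k [].
exact: addeACA.
Qed.

Lemma zsum_set1 (R : realType) (k : int) (f : int -> R) :
  zsum [set k] f = (f k)%:E.
Proof.
have [f0|f0] := leP 0 (f k).
  by rewrite zsum_ge0 ?esum_set1 ?lee_fin // => _ ->.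
rewrite zsum_le0 ?esum_set1 ?lee_fin ?oppr_ge0 ?(ltW f0) -?EFinN ?opprK //.
by move=> _ ->; exact: ltW.
Qed.

Lemma zsum_split (R : realType) (j : int) (f : int -> R) :
  summable setT (EFin \o f) ->
  zsum setT f = (zsum [set k | (k <= j)%R] f + zsum [set k | (j < k)%R] f)%E.
Proof.
move=> sf; rewrite (zsumID [set k | (k <= j)%R]) // !setTI.
by congr (_ + zsum _ _)%E; apply/seteqP; split => k /=; lia.
Qed.

Lemma zsum_recr (R : realType) (j : int) (f : int -> R) :
  summable setT (EFin \o f) ->
  zsum [set k | (k <= j)%R] f = (zsum [set k | (k <= j - 1)%R] f + (f j)%:E)%E.
Proof.
move=> sf; rewrite (zsumID [set k | (k <= j - 1)%R]); last first.
  exact: summable_sub sf.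
rewrite -zsum_set1; congr (zsum _ _ + zsum _ _)%E;
  by apply/seteqP; split => k /=; lia.
Qed.

(** The bridge between mean and centred sum, used both ways: [g k = k p(k)] with [c = x = mu]
    centres a pmf at its mean, and [g k = (mu - k) p(k)] with [c = mu], [x = 0] recovers the
    mean. *)
Lemma zsum_pmf_sub (R : realType) (p g : int -> R) (c x : R) :
  is_pmf p -> summable setT (EFin \o g) -> zsum setT g = x%:E ->
  summable setT (fun k => (c * p k - g k)%:E) /\
  zsum setT (fun k => c * p k - g k) = (c - x)%:E.
Proof.
move=> [p0 p1] sg gx.
have pfin : (\esum_(k in setT) (p k)%:E < +oo)%E by rewrite p1 ltry.
have sM : summable setT (fun k => (c * p k)%:E).
  rewrite /summable; under eq_esum do rewrite /= normrM [`|p _|]ger0_norm //.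
  by rewrite esumZ // p1 mule1 ltry.
split; first exact: (summableB sM sg).
have posE k : ((EFin \o g)^\+ k = (Num.max (g k) 0)%:E)%E.
  by rewrite funeposE EFin_max.
have negE k : ((EFin \o g)^\- k = (Num.max (- g k) 0)%:E)%E.
  by rewrite funenegE EFin_max.
have fP : \esum_(k in setT) (Num.max (g k) 0)%:E \is a fin_num.
  move: (summable_funepos sg); rewrite summableE; congr (_ \is a _).
  by apply: eq_esum => k _; rewrite gee0_abs.
have fN : \esum_(k in setT) (Num.max (- g k) 0)%:E \is a fin_num.
  move: (summable_funeneg sg); rewrite summableE; congr (_ \is a _).
  by apply: eq_esum => k _; rewrite gee0_abs.
have sE a h : 0 <= a -> (forall k, 0 <= h k) ->
    \esum_(k in setT) (a * p k + h k)%:E =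
    (a%:E + \esum_(k in setT) (h k)%:E)%E.
  move=> a0 h0; under eq_esum do rewrite EFinD.
  by rewrite esumD ?esumZ ?p1 ?mule1 // => k _; rewrite lee_fin ?mulr_ge0.
move: gx; rewrite /zsum.
under eq_esum do rewrite posE.
under [X in (_ - X)%E]eq_esum do rewrite negE.
move=> gx.
have m0 (y : R) : 0 <= Num.max y 0 by rewrite le_max lexx orbT.
(* Both [c] and [g] are split by sign, so that the two sums are [c^+ + N] and [c^- + P], where [P]
   and [N] are the finite sums of the parts of [g] and [P - N = x]. *)
rewrite -/(zsum _ _) (@zsumB _ _ _
    (fun k => Num.max c 0 * p k + Num.max (- g k) 0)
    (fun k => Num.max (- c) 0 * p k + Num.max (g k) 0)).
- rewrite !sE //; move: fP fN gx.
  case: (\esum_(_ in _) _)%E => // P _; case: (\esum_(_ in _) _)%E => // N _.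
  move=> -[<-]; congr (_%:E).
  by rewrite /Num.max; do 2 case: ifP; lra.
- by move=> k _; rewrite addr_ge0 ?mulr_ge0.
- by move=> k _; rewrite addr_ge0 ?mulr_ge0.
- by rewrite sE // lte_add_pinfty ?ltry // ltey_eq fN.
- by rewrite sE // lte_add_pinfty ?ltry // ltey_eq fP.
- move=> k.
  have posneg (y : R) : Num.max y 0 - Num.max (- y) 0 = y.
    by rewrite /Num.max; do 2 case: ifP; lra.
  by rewrite -{1}[c]posneg -{1}[g k]posneg; ring.
Qed.

(** * Necessity: the flux of a CO distribution *)

Lemma qlowE (R : realType) (mu : R) (q : {poly R}) (x : R) :
  (qlow mu q).[x] = q.[x] + x - mu.
Proof. by rewrite /qlow !hornerE. Qed.

Section CO_theory.
Variables (R : realType) (mu : R) (q : {poly R}) (p : int -> R).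
Hypothesis COp : CO mu q p.
Let f (k : int) : R := (mu - k%:~R) * p k.
Let F (j : int) : R := q.[j%:~R] * p j.

Lemma CO_ge0 k : 0 <= p k. Proof. by case: COp => _ []. Qed.

Let p0 : forall k, 0 <= p k := CO_ge0.

Lemma CO_centered : summable setT (EFin \o f) /\ zsum setT f = 0%E.
Proof.
case: COp => _ pmfp [sm me] _.
have -> : f = fun k => mu * p k - k%:~R * p k.
  by apply/funext => k; rewrite /f mulrBl.
by have [? ->] := zsum_pmf_sub mu pmfp sm me; rewrite subrr.
Qed.

Let sf : summable setT (EFin \o f). Proof. by case: CO_centered. Qed.

Let zsumF j : zsum [set k | (k <= j)%R] f = (F j)%:E.
Proof. by case: COp => _ _ _; apply. Qed.

Lemma CO_rec j : (qlow mu q).[j%:~R] * p j = q.[(j - 1)%:~R] * p (j - 1).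
Proof.
have := zsumF j; rewrite (zsum_recr _ sf) zsumF -EFinD => -[].
by rewrite /F /f qlowE; lra.
Qed.

Lemma CO_left j : j%:~R < mu ->
  0 <= F j /\ forall k, (k <= j)%R -> 0 < p k -> 0 < F j.
Proof.
move=> jmu; have f0 k : (k <= j)%R -> 0 <= f k.
  by rewrite -(ler_int R) => kj; rewrite mulr_ge0 ?p0 //; lra.
have := zsumF j; rewrite zsum_ge0 // => FE.
split; first by rewrite -lee_fin -FE esum_ge0 // => k /f0; rewrite lee_fin.
move=> k kj pk; rewrite -lte_fin -FE; apply: (@lt_le_trans _ _ (f k)%:E).
  by rewrite lte_fin mulr_gt0 //; move: kj; rewrite -(ler_int R); lra.
apply: esum_ge; exists [set k]; last by rewrite fsbig_set1.
by split => // _ ->.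
Qed.

(** The total of [f] is zero, so [F j] is the sum of [- f] beyond [j]. Strictness in [mu < j + 1]
    lets a single point of mass there force [F j > 0]. *)
Lemma CO_right j : mu < (j + 1)%:~R ->
  0 <= F j /\ forall k, (j < k)%R -> 0 < p k -> 0 < F j.
Proof.
move=> jmu; have kmu k : (j < k)%R -> mu < k%:~R.
  move=> jk; apply: (lt_le_trans jmu); rewrite ler_int; lia.
have f0 k : (j < k)%R -> f k <= 0.
  by move=> /kmu jk; rewrite mulr_le0_ge0 ?p0 //; lra.
have : zsum setT f = 0%E by case: CO_centered.
rewrite (zsum_split j sf) zsumF zsum_le0 // => /eqP.
rewrite sube_eq ?adde0 ?add0e //.
move=> /eqP FE.
split.
  by rewrite -lee_fin FE esum_ge0 // => k /f0; rewrite lee_fin oppr_ge0.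
move=> k jk pk; rewrite -lte_fin FE; apply: (@lt_le_trans _ _ (- f k)%:E).
  by rewrite lte_fin -mulNr mulr_gt0 //; move: (kmu _ jk); lra.
apply: esum_ge; exists [set k]; last by rewrite fsbig_set1.
by split => // _ ->.
Qed.

Lemma CO_flux_ge0 j : 0 <= F j.
Proof.
have [/CO_left[]//|muj] := ltP j%:~R mu.
by apply: (proj1 (CO_right _)); rewrite intrD; lra.
Qed.

Lemma CO_exists_gt0 : exists k, 0 < p k.
Proof.
apply: contrapT => /forallNP np; case: COp => _ [_ +] _ _.
rewrite esum1 => [[/eqP]|k _]; first by rewrite eq_sym oner_eq0.
by congr (_%:E); apply/eqP; rewrite eq_le p0 andbT leNgt; apply/negP/np.
Qed.

End CO_theory.

(* [low_zero] and [up_zero] are the index sets whose sup and inf are alpha and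
   omega; [between_zeros] describes S without extended reals. *)
Definition low_zero (R : realType) (mu : R) (q : {poly R}) (i : int) : Prop :=
  i%:~R <= mu /\ (qlow mu q).[i%:~R] = 0.

Definition up_zero (R : realType) (mu : R) (q : {poly R}) (i : int) : Prop :=
  mu <= i%:~R /\ q.[i%:~R] = 0.

Definition between_zeros (R : realType) (mu : R) (q : {poly R}) (j : int) :
  Prop :=
  (forall i, low_zero mu q i -> (i <= j)%R) /\
  (forall i, up_zero mu q i -> (j <= i)%R).

(** Locates the edge of the mass of [p], and later the extreme zeros of the polynomials; the
    mirrored versions are obtained by substituting [- i]. *)
Lemma int_last_before (P : int -> Prop) (a b : int) :
  (a < b)%R -> P a -> ~ P b ->
  exists k, [/\ (k < b)%R, P k & ~ P (k + 1)].
Proof.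
move=> ab; have [n ->] : exists n : nat, b = a + n%:Z.
  by exists `|b - a|%N; lia.
elim: n {ab b} => [|n IH] Pa; first by rewrite addr0.
have [Pn nP|nPn _] := pselect (P (a + n%:Z)).
  by exists (a + n%:Z); split; [lia | |
    rewrite (_ : _ + 1 = a + n.+1%:Z) //; lia].
by have [k [kn Pk nPk]] := IH Pa nPn; exists k; split => //; lia.
Qed.

(** * Support of a CO distribution and signs of [q] and [qlow] on it *)

Section CO_support.
Variables (R : realType) (mu : R) (q : {poly R}) (p : int -> R).
Hypothesis COp : CO mu q p.

(** Mass beyond a zero would make the flux there positive, whereas the zero makes it vanish.
    Conversely, on the way from a point of mass to a massless [j], the flux vanishes at the edge of
    the mass, which forces a zero before [j] is reached. *)
Lemma CO_support j : 0 < p j <-> between_zeros mu q j.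
Proof.
have p0 := CO_ge0 COp; have rc := CO_rec COp.
split=> [pj|[Aj Wj]].
  split=> i [imu qi]; rewrite leNgt; apply/negP => ij.
    have h : (i - 1)%:~R < mu by rewrite intrB; lra.
    have [_ /(_ j ltac:(lia) pj)] := CO_left COp h.
    by rewrite -rc qi mul0r ltxx.
  have h : mu < (i + 1)%:~R by rewrite intrD; lra.
  have [_ /(_ j ltac:(lia) pj)] := CO_right COp h.
  by rewrite qi mul0r ltxx.
apply: contrapT => npj.
have z k : ~ 0 < p k -> p k = 0.
  by move=> h; apply/eqP; rewrite eq_le p0 andbT leNgt; apply/negP.
have [k0 pk0] := CO_exists_gt0 COp.
have [k0j|jk0|k0j] := ltgtP k0 j; last by apply: npj; rewrite -k0j.
  have [k [/= kj pk /z pk1]] :=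
    @int_last_before (fun i => 0 < p i) _ _ k0j pk0 npj.
  have Fk : q.[k%:~R] * p k = 0.
    by have := rc (k + 1); rewrite pk1 mulr0 addrK.
  have [kmu|muk] := ltP k%:~R mu.
    by have [_ /(_ k (lexx _) pk)] := CO_left COp kmu; rewrite Fk ltxx.
  have qk : q.[k%:~R] = 0.
    by move/eqP: Fk; rewrite mulf_eq0 (gt_eqF pk) orbF => /eqP.
  by have := Wj k (conj muk qk); lia.
(* Downward walk, reflected: [k = - i] carries mass and [k - 1] does not, so the flux at [k - 1],
   which is also [qlow(k) p(k)], is zero. *)
have njk0 : - k0 < - j by lia.
have [] := @int_last_before (fun i => 0 < p (- i)) _ _ njk0.
- by rewrite opprK.
- by rewrite opprK.
move=> i [/= ij pk]; rewrite opprD; set k := - i in pk * => /z pk1.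
have Fk : q.[(k - 1)%:~R] * p (k - 1) = 0 by rewrite pk1 mulr0.
have [muk|kmu] := ltP mu k%:~R.
  have h : mu < (k - 1 + 1)%:~R by rewrite subrK.
  have [_ /(_ k ltac:(lia) pk)] := CO_right COp h.
  by rewrite Fk ltxx.
have qk : (qlow mu q).[k%:~R] = 0.
  move: (rc k); rewrite Fk => /eqP.
  by rewrite mulf_eq0 (gt_eqF pk) orbF => /eqP.
by have := Aj k (conj kmu qk); rewrite /k; lia.
Qed.

(** As [p j > 0], the sign of [q] is that of the flux: positive left of [mu], and right of it
    nonnegative and zero only at an upper zero. *)
Lemma CO_q_gt0 j : between_zeros mu q j -> ~ up_zero mu q j -> 0 < q.[j%:~R].
Proof.
move=> /CO_support pj nW; rewrite -(pmulr_lgt0 _ pj).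
have [jmu|muj] := ltP j%:~R mu; first exact: (proj2 (CO_left COp jmu) j).
rewrite lt_neqAle (CO_flux_ge0 COp) andbT eq_sym mulf_eq0 (gt_eqF pj) orbF.
by apply/eqP => qj; apply: nW.
Qed.

Lemma CO_qlow_gt0 j :
  between_zeros mu q j -> ~ low_zero mu q j -> 0 < (qlow mu q).[j%:~R].
Proof.
move=> /CO_support pj nA; rewrite -(pmulr_lgt0 _ pj).
have [muj|jmu] := ltP mu j%:~R.
  rewrite (CO_rec COp); have h : mu < (j - 1 + 1)%:~R by rewrite subrK.
  by apply: (proj2 (CO_right COp h) j) => //; lia.
rewrite lt_neqAle {2}(CO_rec COp) (CO_flux_ge0 COp) andbT.
rewrite eq_sym mulf_eq0 (gt_eqF pj) orbF.
by apply/eqP => qj; apply: nA.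
Qed.

End CO_support.

(** * Sufficiency: normalizing a solution of the recurrence *)

(** Telescoping would bound the partial sums of the harmonic series by [G 0 / c]. *)
Lemma no_harmonic_descent (R : realType) (c : R) (G : R^nat) :
  0 < c -> (forall n, 0 <= G n) ->
  (forall n, c / n.+1%:R <= G n - G n.+1) -> False.
Proof.
move=> c0 G0 Gc; apply: (@dvg_harmonic R); apply: nondecreasing_is_cvgn.
  apply/nondecreasing_seqP => n; rewrite seriesEnat /= big_nat_recr //=.
  by rewrite lerDl invr_ge0.
exists (G 0%N / c) => _ [n _ <-]; rewrite seriesEnat /=.
rewrite ler_pdivlMr // mulr_suml.
apply: (@le_trans _ _ (\sum_(0 <= k < n) (G k - G k.+1))).
  by apply: ler_sum => k _; rewrite mulrC.
rewrite (telescope_sumr_eq (fun k => - G k)) // => [|k _]; last by ring.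
by have := G0 n; lra.
Qed.

(* If G had a positive limit L, the third hypothesis would make
   G n - G n.+1 at least of order L / n, against the divergence of the
   harmonic series. *)
Lemma esum_flux (R : realType) (G : R^nat) (C : R) :
  (forall n, 0 <= G n) -> (forall n, G n.+1 <= G n) ->
  (forall n, n%:R * G n.+1 <= C * n.+1%:R ^+ 2 * (G n - G n.+1)) ->
  \esum_(n in setT) (G n - G n.+1)%:E = (G 0%N)%:E.
Proof.
move=> G0 Gd GC.
have cG : cvgn G.
  apply: nonincreasing_is_cvgn; first exact/nonincreasing_seqP.
  by exists 0 => _ [n _ <-].
have L0 : limn G = 0.
  set L := limn G; have LG n : L <= G n.
    by apply: nonincreasing_cvgn_ge => //; exact/nonincreasing_seqP.
  apply: contrapT => /eqP nL.
  have Lp : 0 < L.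
    by rewrite lt_neqAle eq_sym nL /=; apply: limr_ge => //; apply: nearW.
  (* The sign of [C] is unknown; the maximum makes it safe to divide by. *)
  pose C' := Num.max C 1.
  have C'0 : 0 < C' by rewrite /C' lt_max ltr01 orbT.
  have CC' : C <= C' by rewrite /C' le_max lexx.
  (* The shift to [G n.+1] avoids the factor [n = 0] in the hypothesis; the 4 comes from
     [(n + 2)^2 <= 4 (n + 1)^2]. *)
  apply: (@no_harmonic_descent R (L / (2 * C' * 2)) (fun n => G n.+1)) => //.
    by rewrite divr_gt0 // !mulr_gt0.
  move=> n; have := GC n.+1; have := LG n.+2; have := Gd n.+1.
  have nn : n.+2%:R <= 2 * n.+1%:R :> R by rewrite -natrM ler_nat; lia.
  have n0 : 0 < n.+1%:R :> R by [].
  have n20 : 0 < n.+2%:R :> R by [].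
  set a := G n.+1; set b := G n.+2; set x := n.+1%:R in nn n0 *.
  set y := n.+2%:R in nn n20 *.
  move=> ba Lb ineq.
  rewrite -mulrA -invfM ler_pdivrMr ?mulr_gt0 //.
  have h1 : x * L <= C' * y ^+ 2 * (a - b).
    apply: (le_trans (y := x * b)); first by rewrite ler_pM2l.
    apply: (le_trans ineq); rewrite ler_wpM2r ?subr_ge0 // ler_wpM2r //.
    by rewrite sqr_ge0.
  have h2 : y ^+ 2 <= 4 * x ^+ 2 by nra.
  have h3 : x * L <= C' * (4 * x ^+ 2) * (a - b).
    apply: (le_trans h1); rewrite ler_wpM2r ?subr_ge0 // ler_wpM2l // ltW //.
  rewrite -(ler_pM2l n0); apply: (le_trans h3).
  by rewrite le_eqVlt; apply/orP; left; apply/eqP; ring.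
rewrite -nneseries_esumT; last by move=> n; rewrite lee_fin subr_ge0.
apply/cvg_lim => //.
rewrite (_ : (fun n => _) = EFin \o (fun n => G 0%N - G n)); last first.
  apply/funext => n /=; rewrite sumEFin.
  congr (_%:E).
  by rewrite (telescope_sumr_eq (fun k => - G k)) // => [|k _]; ring.
apply: cvg_EFin; first exact: nearW.
rewrite -[X in _ --> X]subr0 -L0.
by apply: cvgB => //; exact: cvg_cst.
Qed.

(** Supplies the constant [C] for [esum_flux]: within [n] unit steps of a base point,
    [|x| <= (|x0| + 1) (n + 1)], and each of the three coefficients is bounded separately. *)
Lemma quadratic_bound (R : realType) (q : {poly R}) (x0 : R) :
  (size q <= 3)%N ->
  exists2 C : R, 0 <= C & forall (n : nat) (x : R),
    `|x| <= `|x0| + n%:R -> q.[x] <= C * n.+1%:R ^+ 2.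
Proof.
move=> hq; pose B := `|x0| + 1.
have B1 : 1 <= B by rewrite lerDr.
exists (`|q`_0| + `|q`_1| * B + `|q`_2| * B ^+ 2).
  by rewrite !addr_ge0 ?mulr_ge0 ?sqr_ge0 // (le_trans _ B1).
move=> n x xn; have xB : `|x| <= B * n.+1%:R.
  rewrite -natr1 /B; apply: (le_trans xn).
  by have : 0 <= `|x0| * n%:R by []; have : 0 <= n%:R :> R by []; lra.
have n1 : 1 <= n.+1%:R :> R by rewrite ler1n.
rewrite (horner_coef_wide x hq) !big_ord_recr big_ord0 /=.
rewrite add0r expr0 expr1 mulr1.
rewrite !mulrDl; apply: lerD; first apply: lerD.
- apply: (le_trans (ler_norm _)); rewrite ler_peMr // expr2.
  by rewrite -[leLHS]mulr1 ler_pM.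
- apply: (le_trans (ler_norm _)); rewrite normrM -mulrA ler_wpM2l //.
  apply: (le_trans xB); rewrite ler_wpM2l ?(le_trans _ B1) // expr2.
  by rewrite ler_peMr.
- apply: (le_trans (ler_norm _)); rewrite normrM -mulrA -exprMn ler_wpM2l //.
  by rewrite normrX lerXn2r // nnegrE ?mulr_ge0 // (le_trans _ B1).
Qed.

Section CO_of_recurrence.
Variables (R : realType) (mu : R) (q : {poly R}) (p : int -> R).
Hypothesis hq : (size q <= 3)%N.
Hypothesis p0 : forall k, 0 <= p k.
Hypothesis rc :
  forall j, (qlow mu q).[j%:~R] * p j = q.[(j - 1)%:~R] * p (j - 1).
Hypothesis F0 : forall j, 0 <= q.[j%:~R] * p j.
Let f (k : int) : R := (mu - k%:~R) * p k.
Let F (j : int) : R := q.[j%:~R] * p j.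

Let fF j : f j = F j - F (j - 1).
Proof. by rewrite /F -rc qlowE /f; ring. Qed.

(** Along [k = j - n] the terms are the decrements of [G n = F (j - n)], so the sum telescopes to
    [F j]. The growth condition holds because [q(k) <= C (n + 1)^2] and [n <= mu - k]. *)
Lemma esum_left_flux j :
  j%:~R <= mu -> \esum_(k in [set k | (k <= j)%R]) (f k)%:E = (F j)%:E.
Proof.
move=> jmu; have [C C0 qC] := quadratic_bound j%:~R hq.
rewrite (@reindex_esum _ _ _ setT _ (fun n : nat => j - n%:Z)); last first.
  split=> [n _|n n' _ _|k /= kj]; [rewrite /=; lia | lia |].
  by exists `|j - k|%N => //; lia.
pose G n := F (j - n%:Z).
have fG n : f (j - n%:Z) = G n - G n.+1.
  by rewrite fF /G; congr (_ - F _); lia.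
under eq_esum do rewrite fG.
have muk n : n%:R <= mu - (j - n%:Z)%:~R by rewrite intrB; lra.
have Gd n : G n.+1 <= G n.
  by rewrite -subr_ge0 -fG mulr_ge0 // (le_trans _ (muk n)).
rewrite (esum_flux (G := G) (C := C)) // => [|n|n];
  [by rewrite /G subr0 | exact: F0 |].
(* Passing to [G n] puts the flux and the decrement at the same index [j - n]. *)
apply: (@le_trans _ _ (n%:R * G n)); first by rewrite ler_wpM2l.
rewrite -fG /G /F /f; have {muk Gd} := muk n; set k := j - n%:Z => muk.
apply: (@le_trans _ _ (n%:R * (C * n.+1%:R ^+ 2 * p k))).
  rewrite ler_wpM2l //; apply: ler_wpM2r => //; apply: qC.
  rewrite /k intrB; apply: (le_trans (ler_normB _ _)); rewrite lerD2l.
  by rewrite ger0_norm.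
rewrite mulrCA; apply: ler_wpM2l; first by rewrite mulr_ge0 ?sqr_ge0.
by apply: ler_wpM2r.
Qed.

Lemma esum_right_flux j : mu <= (j + 1)%:~R ->
  \esum_(k in [set k | (j < k)%R]) (- f k)%:E = (F j)%:E.
Proof.
move=> jmu; have [C C0 qC] := quadratic_bound (j + 1)%:~R hq.
rewrite (@reindex_esum _ _ _ setT _ (fun n : nat => j + 1 + n%:Z)); last first.
  split=> [n _|n n' _ _|k /= kj]; [rewrite /=; lia | lia |].
  by exists `|(k - (j + 1))%R|%N => //; lia.
pose G n := F (j + n%:Z).
have fG n : - f (j + 1 + n%:Z) = G n - G n.+1.
  by rewrite fF /G opprB; congr (F _ - F _); lia.
under eq_esum do rewrite fG.
have muk n : n%:R <= (j + 1 + n%:Z)%:~R - mu by rewrite intrD; lra.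
have Gd n : G n.+1 <= G n.
  by rewrite -subr_ge0 -fG -mulNr opprB mulr_ge0 // (le_trans _ (muk n)).
rewrite (esum_flux (G := G) (C := C)) // => [|n|n];
  [by rewrite /G addr0 | exact: F0 |].
(* On this side [G n.+1] itself sits at the index of the decrement. *)
have kE : j + n.+1%:Z = j + 1 + n%:Z by lia.
rewrite -fG /G /F /f kE -mulNr opprB.
set k := j + 1 + n%:Z in muk *.
apply: (@le_trans _ _ (n%:R * (C * n.+1%:R ^+ 2 * p k))).
  rewrite ler_wpM2l //; apply: ler_wpM2r => //; apply: qC.
  rewrite /k intrD; apply: (le_trans (ler_normD _ _)); rewrite lerD2l.
  by rewrite ger0_norm.
rewrite mulrCA; apply: ler_wpM2l; first by rewrite mulr_ge0 ?sqr_ge0.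
by apply: ler_wpM2r => //; exact: muk.
Qed.

Lemma flux_summable : summable setT (EFin \o f).
Proof.
set m := Num.floor mu.
have /andP[mmu mum] : m%:~R <= mu < (m + 1)%:~R by exact: floor_itv.
rewrite /summable (esumID [set k | (k <= m)%R]) // !setTI.
rewrite (_ : \esum_(_ in _) _ = (F m)%:E)%E; last first.
  rewrite -esum_left_flux //; apply: eq_esum => k /= km.
  rewrite ger0_norm // mulr_ge0 //.
  by move: km; rewrite -(ler_int R); lra.
rewrite (_ : \esum_(_ in _) _ = (F m)%:E)%E -?EFinD ?ltry //.
rewrite -esum_right_flux ?ltW //.
rewrite (_ : ~` _ = [set k | (m < k)%R]); last first.
  by apply/seteqP; split => k /=; lia.
apply: eq_esum => k /= km; rewrite ler0_norm // mulr_le0_ge0 //.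
rewrite subr_le0; apply: (le_trans (ltW mum)); rewrite ler_int; lia.
Qed.

Let zsum_left j : j%:~R <= mu -> zsum [set k | (k <= j)%R] f = (F j)%:E.
Proof.
move=> jmu; rewrite zsum_ge0 ?esum_left_flux // => k /=.
by rewrite -(ler_int R) => km; rewrite mulr_ge0 // subr_ge0; lra.
Qed.

Let zsum_right j :
  mu <= (j + 1)%:~R -> zsum [set k | (j < k)%R] f = (- (F j)%:E)%E.
Proof.
move=> jmu; rewrite zsum_le0 ?esum_right_flux // => k /= jk.
rewrite mulr_le0_ge0 // subr_le0; apply: (le_trans jmu).
by rewrite ler_int; lia.
Qed.

Lemma zsum_flux_total : zsum setT f = 0%:E.
Proof.
have /andP[mmu mum] := floor_itv mu.
rewrite (zsum_split (Num.floor mu) flux_summable).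
by rewrite zsum_left // zsum_right ?ltW // subee.
Qed.

(** Right of [mu] the value is read off from the right tail, which it cancels in a total of zero. *)
Lemma zsum_flux j : zsum [set k | (k <= j)%R] f = (F j)%:E.
Proof.
have [/zsum_left//|muj] := leP j%:~R mu.
have := zsum_flux_total; rewrite (zsum_split j flux_summable) zsum_right.
  have : zsum [set k | (k <= j)%R] f \is a fin_num.
    by apply: zsum_fin_num; exact: summable_sub flux_summable.
  by case: (zsum _ _) => // x _ [/eqP]; rewrite subr_eq0 => /eqP ->.
by rewrite intrD; lra.
Qed.

(** Away from [m] and [m + 1], where [m] is the floor of [mu], one has [|mu - k| >= 1] and hence
    [p k <= |f k|], which is summable. *)
Lemma esum_recurrence_lty : (\esum_(k in setT) (p k)%:E < +oo)%E.
Proof.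
set m := Num.floor mu.
have /andP[mmu mum] : m%:~R <= mu < (m + 1)%:~R by exact: floor_itv.
have le1 D a : (\esum_(k in D `&` [set a]) (p k)%:E < +oo)%E.
  rewrite setI1; case: ifP => _; last by rewrite esum_set0.
  by rewrite esum_set1 ?ltry ?lee_fin.
have pE k : [set: int] k -> (0 <= (p k)%:E)%E by rewrite lee_fin.
rewrite (esumID [set m]) //; apply: lte_add_pinfty; first exact: le1.
rewrite (esumID [set (m + 1)%R]); last by move=> k [/pE].
apply: lte_add_pinfty; first exact: le1.
apply: le_lt_trans flux_summable.
apply: (@le_trans _ _ (\esum_(k in setT `&` ~` [set m] `&` ~` [set (m + 1)%R])
   `|(EFin \o f) k|)%E).
  apply: le_esum => k /= [[_ km] km1]; rewrite lee_fin normrM.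
  rewrite (ger0_norm (p0 k)) ler_peMl //.
  have [|] : (k <= m - 1)%R \/ (m + 1 + 1 <= k)%R by lia.
    by rewrite -(ler_int R) intrB => h; rewrite ger0_norm; lra.
  by rewrite -(ler_int R) intrD => h; rewrite ler0_norm; lra.
rewrite [leRHS](esumID (setT `&` ~` [set m] `&` ~` [set (m + 1)%R])) //.
rewrite [X in (_ <= \esum_(_ in X) _ + _)%E]setTI leeDl //.
exact: esum_ge0.
Qed.

Lemma CO_of_rec : (\esum_(k in setT) (p k)%:E = 1)%E -> CO mu q p.
Proof.
move=> p1; have pmfp : is_pmf p by [].
have [s z] := zsum_pmf_sub mu pmfp flux_summable zsum_flux_total.
have fE k : k%:~R * p k = mu * p k - f k by rewrite /f; ring.
split => //; last exact: zsum_flux.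
split; first by under eq_fun do rewrite fE.
by under eq_fun do rewrite fE; rewrite z subr0.
Qed.

End CO_of_recurrence.

(** The recurrence and the sign condition are homogeneous in [p], so they survive division by the
    total mass, which is finite and positive. *)
Lemma admissible_of_rec (R : realType) (mu : R) (q : {poly R}) (p : int -> R) :
  (size q <= 3)%N -> (forall k, 0 <= p k) -> (exists k, 0 < p k) ->
  (forall j, (qlow mu q).[j%:~R] * p j = q.[(j - 1)%:~R] * p (j - 1)) ->
  (forall j, 0 <= q.[j%:~R] * p j) -> admissible mu q.
Proof.
move=> hq p0 [k pk] rc F0.
have := esum_recurrence_lty hq p0 rc F0.
have : ((p k)%:E <= \esum_(k in setT) (p k)%:E)%E.
  by apply: esum_ge; exists [set k]; [split => // | rewrite fsbig_set1].
case E : (\esum_(_ in _) _)%E => [t||] //; rewrite lee_fin => pt _.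
have t0 : 0 < t by exact: lt_le_trans pt.
exists (fun k => t^-1 * p k); apply: CO_of_rec => //.
- by move=> i; rewrite mulr_ge0 // invr_ge0 ltW.
- by move=> j; rewrite mulrCA rc mulrCA.
- by move=> j; rewrite mulrCA mulr_ge0 // invr_ge0 ltW.
- rewrite esumZ ?E // ?invr_ge0 ?ltW //.
  by rewrite -EFinM mulVf // gt_eqF.
Qed.

(** * Endpoints and explicit formulas *)

Section zeros.
Variables (R : realType) (mu : R) (q : {poly R}).

(** The zeros are integers bounded by the floor of [mu], so a nonempty set of them has a maximum:
    the last [i] with some zero at or above it. *)
Lemma CO_alpha_cases :
  (exists a, [/\ low_zero mu q a, CO_alpha mu q = (a%:~R : R)%:E &
                 forall i, low_zero mu q i -> (i <= a)%R]) \/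
  CO_alpha mu q = -oo%E /\ forall i, ~ low_zero mu q i.
Proof.
have [[i0 zi0]|nz] := pselect (exists i, low_zero mu q i); [left|right].
  have le_floor i : low_zero mu q i -> (i <= Num.floor mu)%R.
    by case=> imu _; rewrite floor_ge_int.
  have i0m : (i0 < Num.floor mu + 1)%R by have := le_floor _ zi0; lia.
  have [] := @int_last_before
    (fun i => exists2 k, (i <= k)%R & low_zero mu q k) _ _ i0m.
  - by exists i0.
  - by move=> [k mk /le_floor]; lia.
  move=> a [_ [k ak zk] na]; have ka : k = a.
    apply/eqP; rewrite eq_le ak andbT leNgt; apply/negP => ?; apply: na.
    by exists k => //; lia.
  move: zk; rewrite ka => za; exists a.
  have ub i : low_zero mu q i -> (i <= a)%R.
    move=> zi; rewrite leNgt; apply/negP => ?; apply: na.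
    by exists i => //; lia.
  split => //; apply/eqP; rewrite eq_le; apply/andP; split.
    by apply: ge_ereal_sup => _ [i zi <-]; rewrite lee_fin ler_int; apply: ub.
  by apply: ereal_sup_ubound; exists a.
have nz' i : ~ low_zero mu q i by move=> zi; apply: nz; exists i.
split => //; rewrite /CO_alpha (_ : [set j | _] = set0).
  by rewrite image_set0 ereal_sup0.
by apply/seteqP; split => // i /nz'.
Qed.

Lemma CO_omega_cases :
  (exists w, [/\ up_zero mu q w, CO_omega mu q = (w%:~R : R)%:E &
                 forall i, up_zero mu q i -> (w <= i)%R]) \/
  CO_omega mu q = +oo%E /\ forall i, ~ up_zero mu q i.
Proof.
have [[i0 zi0]|nz] := pselect (exists i, up_zero mu q i); [left|right].
  have ge_floor i : up_zero mu q i -> (Num.floor mu <= i)%R.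
    by case=> mui _; rewrite -(ler_int R) (le_trans (floor_le _)).
  have i0m : (- i0 < - (Num.floor mu - 1))%R by have := ge_floor _ zi0; lia.
  (* The search runs over [- i], turning the minimum into a maximum. *)
  have [] := @int_last_before
    (fun i => exists2 k, (k <= - i)%R & up_zero mu q k) _ _ i0m.
  - by exists i0 => //; rewrite opprK.
  - by move=> [k mk /ge_floor]; lia.
  move=> a [_ [k ak zk] na]; have ka : k = - a.
    apply/eqP; rewrite eq_le ak leNgt; apply/negP => ?; apply: na.
    by exists k => //; lia.
  move: zk; rewrite ka => za; exists (- a).
  have lb i : up_zero mu q i -> (- a <= i)%R.
    move=> zi; rewrite leNgt; apply/negP => ?; apply: na.
    by exists i => //; lia.
  split => //; apply/eqP; rewrite eq_le; apply/andP; split.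
    by apply: ereal_inf_lbound; exists (- a).
  by apply: le_ereal_inf_tmp => _ [i zi <-]; rewrite lee_fin ler_int; apply: lb.
have nz' i : ~ up_zero mu q i by move=> zi; apply: nz; exists i.
split => //; rewrite /CO_omega (_ : [set j | _] = set0).
  by rewrite image_set0 ereal_inf0.
by apply/seteqP; split => // i /nz'.
Qed.

Lemma CO_setP j : CO_set mu q j <-> between_zeros mu q j.
Proof.
split=> [/andP[aj jw]|[aj jw]].
  split=> i zi; rewrite -(ler_int R) -lee_fin.
    by apply: le_trans aj; apply: ereal_sup_ubound; exists i.
  by apply: (le_trans jw); apply: ereal_inf_lbound; exists i.
apply/andP; split.
  by apply: ge_ereal_sup => _ [i zi <-]; rewrite lee_fin ler_int; apply: aj.
by apply: le_ereal_inf_tmp => _ [i zi <-]; rewrite lee_fin ler_int; apply: jw.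
Qed.

(** An upper zero is at least omega and a point of [S] at most omega, so removing omega from [S]
    removes exactly its upper zeros. *)
Lemma CO_setDomegaP j :
  CO_setDomega mu q j <-> between_zeros mu q j /\ ~ up_zero mu q j.
Proof.
split=> -[/CO_setP bj nj]; split => //; [move=> zj | move=> /= jw]; apply: nj.
  apply/eqP; rewrite eq_le; apply/andP; split.
    by have /CO_setP/andP[] := bj.
  by apply: ereal_inf_lbound; exists j.
have [[w [zw wE _]]|[wE _]] := CO_omega_cases; rewrite wE in jw => //.
by case: jw => /intr_inj ->.
Qed.

Lemma CO_setDalphaP j :
  CO_setDalpha mu q j <-> between_zeros mu q j /\ ~ low_zero mu q j.
Proof.
split=> -[/CO_setP bj nj]; split => //; [move=> zj | move=> /= jw]; apply: nj.
  apply/eqP; rewrite eq_le; apply/andP; split.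
    by apply: ereal_sup_ubound; exists j.
  by have /CO_setP/andP[] := bj.
have [[w [zw wE _]]|[wE _]] := CO_alpha_cases; rewrite wE in jw => //.
by case: jw => /intr_inj ->.
Qed.

Lemma between_convex a b c : between_zeros mu q a -> between_zeros mu q c ->
  (a <= b)%R -> (b <= c)%R -> between_zeros mu q b.
Proof.
move=> [la _] [_ uc] ab bc.
by split=> i zi; [have := la i zi | have := uc i zi]; lia.
Qed.

(** [S] is never empty; the floor of [mu] serves as base point for existence and uniqueness. *)
Lemma between_floor : between_zeros mu q (Num.floor mu).
Proof.
split=> i [imu _]; first by rewrite floor_ge_int.
by rewrite -(ler_int R) (le_trans (floor_le _)).
Qed.

(** [S] can be left downwards only through a lower zero, which is what makes the recurrence hold
    across the boundary. *)
Lemma between_pred j :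
  between_zeros mu q j -> ~ between_zeros mu q (j - 1) -> low_zero mu q j.
Proof.
move=> [lj uj] nb; apply: contrapT => nz; apply: nb; split=> i zi.
  have [ij|/eqP ij] := eqVneq i j; first by rewrite ij in zi.
  by have := lj i zi; lia.
by have := uj i zi; lia.
Qed.

Lemma between_succ j :
  between_zeros mu q j -> ~ between_zeros mu q (j + 1) -> up_zero mu q j.
Proof.
move=> [lj uj] nb; apply: contrapT => nz; apply: nb; split=> i zi.
  by have := lj i zi; lia.
have [ij|/eqP ij] := eqVneq i j; first by rewrite ij in zi.
by have := uj i zi; lia.
Qed.

End zeros.

(** * Ascending products along an interval of integers *)

Lemma asc_succ (R : realType) (f : int -> R) (k x : int) :
  f (x + k) != 0 -> asc f (k + 1) x = asc f k x * f (x + k).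
Proof.
case: k => [n|[|n]] fn0.
- by rewrite (_ : Posz n + 1 = Posz n.+1) ?[asc _ n.+1 _]big_ord_recr //; lia.
(* For negative [k], [f (x + k)] is the last factor of the inverted product and must cancel, hence
   the nonvanishing hypothesis. *)
- rewrite (_ : Negz 0 + 1 = 0) //= big_ord0 big_ord_recr big_ord0 /= mul1r.
  by rewrite mulVf.
- rewrite (_ : Negz n.+1 + 1 = Negz n) /=; last by lia.
  rewrite [in RHS]big_ord_recr /= -[x - n.+2%:Z]/(x + Negz n.+1).
  by rewrite invfM -mulrA mulVf ?mulr1.
Qed.

Section interval.
Variables (R : realType) (I : int -> Prop) (r : int -> R).
Hypothesis convI :
  forall a b c, I a -> I c -> (a <= b)%R -> (b <= c)%R -> I b.
Hypothesis r_gt0 : forall j, I j -> I (j + 1) -> 0 < r j.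

Lemma asc_gt0 x k : I x -> I (x + k) -> 0 < asc r k x.
Proof.
case: k => n Ix In /=; rewrite ?invr_gt0; apply: prodr_gt0 => i _;
  have ni := ltn_ord i.
  by apply: r_gt0; apply: (convI Ix In); lia.
by apply: r_gt0; apply: (convI In Ix); rewrite ?NegzE; lia.
Qed.

(** Induction from [x] in both directions; convexity keeps the intermediate points in [I], and the
    downward step divides by a positive ratio. *)
Lemma geometric_asc (p : int -> R) x k :
  (forall j, I j -> I (j + 1) -> p (j + 1) = r j * p j) ->
  I x -> I (x + k) -> p (x + k) = p x * asc r k x.
Proof.
move=> pr Ix; elim/int_rect: k => [|n IH|n IH] In.
- by rewrite addr0 /= big_ord0 mulr1.
- have In' : I (x + n%:Z) by apply: (convI Ix In); lia.
  have E : x + n.+1%:Z = x + n%:Z + 1 by lia.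
  rewrite E in In *.
  rewrite pr // IH // (_ : n.+1%:Z = n%:Z + 1); last by lia.
  by rewrite asc_succ ?gt_eqF ?r_gt0 //; ring.
- have In' : I (x - n%:Z) by apply: (convI In Ix); lia.
  have E : x - n%:Z = x - n.+1%:Z + 1 by lia.
  have rk : 0 < r (x - n.+1%:Z) by apply: r_gt0 => //; rewrite -E.
  apply: (mulfI (lt0r_neq0 rk)); rewrite -pr // -E // IH //.
  rewrite (_ : - n%:Z = - n.+1%:Z + 1); last by lia.
  by rewrite asc_succ ?gt_eqF //; ring.
Qed.

End interval.

(** * Existence, explicit form and uniqueness of the CO distribution *)

Section CO_characterisation.
Variables (R : realType) (mu : R) (q : {poly R}).
Let I := between_zeros mu q.
Let r := CO_ratio mu q.

(** With [j] and [j + 1] both in [S], [j] is not an upper zero and [j + 1] is not a lower one. *)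
Lemma CO_ratio_gt0 :
  (forall j, I j -> ~ up_zero mu q j -> 0 < q.[j%:~R]) ->
  (forall j, I j -> ~ low_zero mu q j -> 0 < (qlow mu q).[j%:~R]) ->
  forall j, I j -> I (j + 1) -> 0 < r j.
Proof.
move=> qp lp j Ij Ij1; rewrite divr_gt0 //.
  by apply: qp => // zj; have := (proj2 Ij1) j zj; lia.
by apply: lp => // zj; have := (proj1 Ij) _ zj; lia.
Qed.

(** Starting the product at the floor of [mu], rather than at an endpoint, treats finite and
    infinite endpoints uniformly. *)
Lemma admissible_of_gt0 : (size q <= 3)%N ->
  (forall j, I j -> ~ up_zero mu q j -> 0 < q.[j%:~R]) ->
  (forall j, I j -> ~ low_zero mu q j -> 0 < (qlow mu q).[j%:~R]) ->
  admissible mu q.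
Proof.
move=> hq qp lp; have rp := CO_ratio_gt0 qp lp.
set m := Num.floor mu; have Im : I m by exact: between_floor.
pose p k := if `[< I k >] then asc r (k - m) m else 0.
have pI k : I k -> p k = asc r (k - m) m by move=> Ik; rewrite /p asboolT.
have pnI k : ~ I k -> p k = 0 by move=> Ik; rewrite /p asboolF.
have pgt0 k : I k -> 0 < p k.
  move=> Ik; rewrite pI //; apply: (asc_gt0 (@between_convex R mu q) rp) => //.
  by rewrite addrC subrK.
have p0 k : 0 <= p k.
  by have [/pgt0/ltW//|/pnI ->] := pselect (I k).
apply: (admissible_of_rec hq p0); first by exists m; exact: pgt0.
(* Inside [S] this is the definition of [r]; at each boundary one side has a zero polynomial value
   and the other a zero mass. *)
- move=> j; have [Ij|nIj] := pselect (I j);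
    have [Ij1|nIj1] := pselect (I (j - 1)).
  + have rj : 0 < r (j - 1) by apply: rp => //; rewrite subrK.
    have E : m + (j - 1 - m) = j - 1 by ring.
    rewrite [p j]pI // (_ : j - m = j - 1 - m + 1); last by ring.
    rewrite asc_succ E ?gt_eqF // -pI // /r /CO_ratio subrK.
    have lj : 0 < (qlow mu q).[j%:~R].
      by apply: lp => // zj; have := (proj1 Ij1) _ zj; lia.
    by field; rewrite gt_eqF.
  + have [_ ->] := between_pred Ij nIj1.
    by rewrite (pnI (j - 1)) // mulr0 mul0r.
  + have [|_ ->] := @between_succ _ _ _ (j - 1) Ij1; first by rewrite subrK.
    by rewrite pnI // mulr0 mul0r.
  + by rewrite !pnI // !mulr0.
- move=> j; have [Ij|nIj] := pselect (I j); last by rewrite pnI // mulr0.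
  have [[_ ->]|nz] := pselect (up_zero mu q j); first by rewrite mul0r.
  by rewrite mulr_ge0 // ltW // qp.
Qed.

(** The base point [x] is arbitrary in [S], so the three explicit formulas are the instances alpha,
    omega and 0. *)
Lemma CO_asc (p : int -> R) x k : CO mu q p ->
  I x -> I (x + k) -> p (x + k) = p x * asc r k x.
Proof.
move=> COp; apply: geometric_asc; first exact: between_convex.
  by apply: CO_ratio_gt0 => j; [exact: CO_q_gt0 COp j|exact: CO_qlow_gt0 COp j].
move=> j Ij Ij1; have lj : 0 < (qlow mu q).[(j + 1)%:~R].
  by apply: (CO_qlow_gt0 COp) => // zj; have := (proj1 Ij) _ zj; lia.
apply: (mulfI (lt0r_neq0 lj)); rewrite (CO_rec COp) addrK /r /CO_ratio.
by field; rewrite gt_eqF.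
Qed.

(** Both pmfs are fixed by their values at the floor of [mu], hence proportional; total mass 1 makes
    the factor 1. *)
Lemma CO_unique (p1 p2 : int -> R) : CO mu q p1 -> CO mu q p2 -> p1 = p2.
Proof.
move=> CO1 CO2; set m := Num.floor mu.
have Im : I m by exact: between_floor.
have m1 : 0 < p1 m by apply/(CO_support CO1).
have m2 : 0 < p2 m by apply/(CO_support CO2).
have z p k : CO mu q p -> ~ I k -> p k = 0.
  move=> COp nI; apply/eqP; rewrite eq_le (CO_ge0 COp) andbT leNgt.
  by apply/negP => /(CO_support COp).
have E k : p2 k = p2 m / p1 m * p1 k.
  have [Ik|nI] := pselect (I k); last by rewrite (z p1 k) // (z p2 k) // mulr0.
  have Ek : k = m + (k - m) by ring.
  rewrite Ek in Ik *; rewrite !CO_asc //; field; exact: lt0r_neq0.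
have c1 : p2 m / p1 m = 1.
  have [_ [_ s1] _ _] := CO1; have [_ [_ s2] _ _] := CO2.
  move: s2; under eq_esum do rewrite E.
  rewrite esumZ ?s1 ?mule1 => [[]//||]; first by rewrite divr_ge0 ?ltW.
  exact: CO_ge0 CO1.
by apply/funext => k; rewrite E c1 mul1r.
Qed.

End CO_characterisation.

Theorem mainTheorem7 (R : realType) (mu : R) (q : {poly R})
    (hq : (size q <= 3)%N) :
  (admissible mu q <->
     (forall j, CO_setDomega mu q j -> 0 < q.[j%:~R]) /\
     (forall j, CO_setDalpha mu q j -> 0 < (qlow mu q).[j%:~R])) /\
  (admissible mu q ->
     (exists! p : int -> R, CO mu q p) /\
     forall p : int -> R, CO mu q p ->
     [/\ [set j | 0 < p j] = CO_set mu q,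
         (-oo < CO_alpha mu q)%E ->
           exists2 a : int, CO_alpha mu q = (a%:~R : R)%:E &
             propto [set i : nat | (((a + i%:Z)%:~R : R)%:E <= CO_omega mu q)%E]
               (fun i => p (a + i%:Z))
               (fun i => asc (CO_ratio mu q) i%:Z a),
         CO_alpha mu q = -oo%E -> (CO_omega mu q < +oo)%E ->
           exists2 w : int, CO_omega mu q = (w%:~R : R)%:E &
             propto [set: nat]
               (fun i => p (w - i%:Z))
               (fun i => asc (CO_ratio mu q) (- i%:Z) w) &
         CO_alpha mu q = -oo%E -> CO_omega mu q = +oo%E ->
           propto [set: int] p (fun j => asc (CO_ratio mu q) j 0)]).
Proof.
have nec : admissible mu q ->
    (forall j, CO_setDomega mu q j -> 0 < q.[j%:~R]) /\
    (forall j, CO_setDalpha mu q j -> 0 < (qlow mu q).[j%:~R]).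
  move=> [p COp]; split=> j.
    by move=> /CO_setDomegaP[Ij nz]; exact: CO_q_gt0 COp _ Ij nz.
  by move=> /CO_setDalphaP[Ij nz]; exact: CO_qlow_gt0 COp _ Ij nz.
split.
  split=> // -[qp lp]; apply: admissible_of_gt0 => // j Ij nz.
    by apply: qp; apply/CO_setDomegaP.
  by apply: lp; apply/CO_setDalphaP.
move=> [p0 COp0]; split.
  by exists p0; split=> // p COp; exact: CO_unique COp0 COp.
move=> p COp; have supp := CO_support COp; split.
- apply/seteqP; split=> j /=.
    by move=> /supp Ij; apply/CO_setP.
  by move=> /CO_setP Ij; apply/supp.
- move=> aoo; have [[a [[amu za] aE ub]]|[aE _]] := CO_alpha_cases mu q;
    last by rewrite aE in aoo.
  (* [a <= mu <= i] for every upper zero [i], so alpha itself belongs to [S]. *)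
  have Ia : between_zeros mu q a.
    split=> // i [mui _]; rewrite -(ler_int R); exact: le_trans mui.
  exists a => //; exists (p a); first exact/supp.
  move=> i /= aiw; apply: (CO_asc COp) => //; apply/CO_setP/andP; split => //.
  by rewrite aE lee_fin ler_int; lia.
- move=> aE woo; have [[w [[muw zw] wE lb]]|[wE _]] := CO_omega_cases mu q;
    last by rewrite wE in woo.
  have Iw : between_zeros mu q w.
    split=> // i [imu _]; rewrite -(ler_int R); exact: le_trans imu _.
  exists w => //; exists (p w); first exact/supp.
  move=> i /= _; apply: (CO_asc COp) => //; apply/CO_setP/andP; split => //.
    by rewrite aE leNye.
  by rewrite wE lee_fin ler_int; lia.
(* With both endpoints infinite [S] is all of the integers, so 0 can be the base point. *)
- move=> aE wE; have Ij j : between_zeros mu q j.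
    by apply/CO_setP; rewrite /CO_set /= aE wE leNye leey.
  exists (p 0); first exact/supp.
  by move=> j _; rewrite -[j in LHS]add0r; apply: (CO_asc COp).
Qed.
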